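(* Let $r\ge 1$ be an integer. If a subset $A\subseteq(\mathbb{Z}/2\mathbb{Z})^r$ satisfies $|2A|<2|A|$, then one of the following holds: (i) there exists a subgroup $H\le(\mathbb{Z}/2\mathbb{Z})^r$ such that $A$ is contained in an $H$-coset and $|A|>|H|/2$; (ii) there exist two subgroups $F,H\le(\mathbb{Z}/2\mathbb{Z})^r$, satisfying $|F|\ge 8$ and $F\cap H=\{0\}$, and an aperiodic antisymmetric subset $S\subseteq F$, such that $A$ is obtained from a shift of the set $S+H$ by removing less than $|H|/2$ of its elements. In this case $2A$ is the sum $F\oplus H$ with one $H$-coset removed, so that $|2A|=(|F|-1)|H|$. Conversely, let $F,H\le(\mathbb{Z}/2\mathbb{Z})^r$ be subgroups satisfying $F\neq\{0\}$ and $F\cap H=\{0\}$, and let $S$ be an antisymmetric subset of $F$. If $A$ is obtained from a shift of the set $S+H$ by removing less than $|H|/2$ of its elements, then $|2A|=(|F|-|\pi(S)|)|H|<2|A|$.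
   Context: $A+B:=\{a+b: a\in A,\ b\in B\}$ and $2A:=A+A$. A shift of a set $T$ is a set of the form $g+T$ with $g$ a group element. The period of a subset $S$ of an abelian group $G$ is the subgroup $\pi(S):=\{g\in G: S+g=S\}$; $S$ is aperiodic if $\pi(S)=\{0\}$. For a non-zero subgroup $H\le(\mathbb{Z}/2\mathbb{Z})^r$ and a non-zero element $h_0\in H$, a subset $S\subseteq H$ is an $h_0$-antisymmetric subset of $H$ if $H$ is the disjoint union $H=S\cup(h_0+S)$. An antisymmetric subset of $H$ is a subset that is $h_0$-antisymmetric for some non-zero $h_0\in H$. *)

(* Defs.v *)
(* MathComp.  Group-theoretic notions (subgroups, sums of sets, cosets) are
   taken from the finite group library.  A [finZmodType] V is canonically a
   [finGroupType] whose law is +%R, so that for A B : {set V} and g : V,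
     (A * B)%g  is the sumset A + B,
     (g *: A)%g is the shift g + A,
     {group V}  is the type of subgroups of V for +%R. *)
From mathcomp Require Import all_boot all_order all_fingroup all_algebra.

Set Implicit Arguments.
Unset Strict Implicit.
Unset Printing Implicit Defensive.

Import GRing.Theory.
Local Open Scope ring_scope.

Fact sumsetE (V : finZmodType) (A B : {set V}) :
  (A * B)%g = [set a + b | a in A, b in B].
Proof. by []. Qed.

Fact shiftE (V : finZmodType) (g : V) (A : {set V}) :
  (g *: A)%g = [set g + a | a in A].
Proof. by rewrite -lcosetE. Qed.

Definition period (V : finZmodType) (S : {set V}) : {set V} :=
  [set g | (S :* g)%g == S].

Lemma period_group_set (V : finZmodType) (S : {set V}) : group_set (period S).
Proof.
apply/group_setP; split=> [|g h]; first by rewrite inE mulg1.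
by rewrite !inE => /eqP Sg /eqP Sh; rewrite rcosetM Sg Sh.
Qed.

Canonical period_group (V : finZmodType) (S : {set V}) : {group V} :=
  Group (period_group_set S).

Definition aperiodic (V : finZmodType) (S : {set V}) : bool :=
  period S == [set 0].

(* H is automatically non-zero here, since it contains h0. *)
Definition antisymmetric_wrt (V : finZmodType)
    (h0 : V) (H : {group V}) (S : {set V}) : bool :=
  [&& h0 \in H, h0 != 0, S \subset H,
      (H : {set V}) == S :|: (h0 *: S)%g & [disjoint S & (h0 *: S)%g]].

Definition antisymmetric_subset (V : finZmodType)
    (H : {group V}) (S : {set V}) : bool :=
  [exists h0 : V, antisymmetric_wrt h0 H S].

(* A arises from a shift of S + H by removing less than |H| / 2 elements. *)
Definition trimmed_shift (V : finZmodType)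
    (S : {set V}) (H : {group V}) (A : {set V}) : Prop :=
  exists g : V, A \subset (g *: (S * H))%g
    /\ (2 * #|(g *: (S * H))%g :\: A| < #|H|)%N.

Definition dense_in_coset (V : finZmodType) (A : {set V}) : Prop :=
  exists (H : {group V}) (g : V),
    A \subset (g *: H)%g /\ (#|H| < 2 * #|A|)%N.

Definition antisymmetric_structure (V : finZmodType)
    (F H : {group V}) (S A : {set V}) : Prop :=
  [/\ (8 <= #|F|)%N, F :&: H = [set 0],
      antisymmetric_subset F S, aperiodic S
    & trimmed_shift S H A].

(* Main.v *)
Require Import Defs.
From mathcomp Require Import all_boot all_order all_fingroup all_algebra.
From mathcomp Require Import all_solvable zify.

Set Implicit Arguments.
Unset Strict Implicit.
Unset Printing Implicit Defensive.

Import GRing.Theory.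
Local Open Scope ring_scope.

(** Additive notation is used in this comment, and 2X stands for X + X.

    _The converse._  Let A come from a shift of S + H by removing less than half
    of |H| elements.  Every H-coset of the shift keeps more than half of its
    elements, and two subsets of an H-coset whose sizes add up to more than |H|
    meet; hence 2A = 2S + H ([trimmed_sumset]).  An element x of F lies outside
    2S exactly when x + S misses S, that is when x + S = h0 + S; so 2S is F
    without h0 + pi(S) ([antisymmetric_sumset]).

    _Kneser._  The direct part rests on Kneser's theorem, |A + pi| + |B + pi| <=
    |A + B| + |pi| with pi the period of A + B ([kneser]).  Each a + b lies in a
    subset C of A + B with |A| + |B| <= |C| + |pi(C)|, found by Dyson transforms
    ([dyson_transform_bound]), and Kemperman's lemma [kemperman_union] says that
    such subsets are closed under union.

    _The direct part._  Let |2A| < 2|A| and H = pi(2A).  Kneser gives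
    |2A| + |H| = 2|A + H|, so A may be replaced by A + H.  If 2A is not H, take
    e in 2A outside H.  In a group of exponent two the sets B = A cap (e + A) and
    D = A cup (e + A) are e-periodic, B + D lies in 2A and |B| + |D| = 2|A|.
    Let K = pi(B + D), which contains e, and let R = 2A minus (B + D), which is
    not empty since e is not a period of 2A.  Kneser for (B, D) is an equality,
    and shows that B and D together miss exactly |K| - |H| - |R| points of their
    K-closures.

    If a + b lies in R, then B misses the K-cosets of a and b, so that A contains
    exactly half of D on each of them; the count of missing points makes these
    two fibres of A large, which forces R into one coset c + K ([R_coset]).  Let C
    be the part of c + K outside R.  The fibre of A at a, added to C, avoids the
    fibre at b; as the fibres are half of those of D, Kneser's theorem leaves
    room only if C lies in one coset of the period of that sum ([C_stab]).
    Consequently the differences of C are periods of 2A, and C is one coset of H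
    ([C_coset]).  So 2A is 2E minus an H-coset, with E = A + K.  Now c has few
    representations as a sum of two elements of E, and Kneser's theorem shows
    that 2E must then be a subgroup ([few_representations_double_group]).

    Finally, let F be a complement of H in the subgroup 2E, and cut a translate of
    A + H by F: this gives S ([small_doubling_classification]). *)

(** The library reaches the finite type under a group along two inheritance
    paths, so that equal cardinals may differ syntactically; they are unified
    first.  Cardinals are then generalized and the context is dropped because
    [lia] compares all atoms up to conversion, which is very slow on sets. *)
Ltac card_lia :=
  repeat match goal with |- context [fingroup_FinStarMonoid__to__fintype_Finite
      (fingroup_FinGroup__to__fingroup_FinStarMonoid ?gT)] =>
    change (fingroup_FinStarMonoid__to__fintype_Finite
      (fingroup_FinGroup__to__fingroup_FinStarMonoid gT))
    with (fingroup_FinGroup__to__fintype_Finite gT)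
  end;
  repeat match goal with |- context [@card.body ?T ?A] =>
    generalize (@card.body T A)
  end;
  try clear; lia.

(** * Periods of sets in a finite abelian group *)

Section AbelianGroup.
Local Open Scope group_scope.
Variable gT : finGroupType.
Hypothesis commG : forall x y : gT, x * y = y * x.
Implicit Types (A B C S X Y : {set gT}) (H K : {group gT}) (g x y : gT).

(** The period over an arbitrary finite group; over a finite Z-module it is
    convertible to [period]. *)
Definition stab S : {set gT} := [set g | S :* g == S].

Lemma stab_group_set S : group_set (stab S).
Proof.
apply/group_setP; split=> [|g h]; first by rewrite inE mulg1.
by rewrite !inE => /eqP Sg /eqP Sh; rewrite rcosetM Sg Sh.
Qed.

Canonical stab_group S := Group (stab_group_set S).

Lemma sumsetC A B : A * B = B * A.
Proof. by apply/setP=> x; apply/mulsgP/mulsgP=> -[a b Aa Bb ->]; exists b a; rewrite // commG. Qed.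

Lemma stabP g S : reflect (forall x, (x * g \in S) = (x \in S)) (g \in stab S).
Proof.
rewrite inE; apply: (iffP eqP) => [Sg x | Sg].
  by rewrite -{1}Sg mem_rcoset mulgK.
by apply/setP=> x; rewrite mem_rcoset -Sg mulgKV.
Qed.

(** By finiteness an inclusion S + g in S is an equality. *)
Lemma sub_stab g S : (forall x, x \in S -> x * g \in S) -> g \in stab S.
Proof.
move=> Sg; rewrite inE eqEcard card_rcoset leqnn andbT.
by apply/subsetP=> x /rcosetP[y Sy ->]; apply: Sg.
Qed.

Lemma stabU g A B : g \in stab A -> g \in stab B -> g \in stab (A :|: B).
Proof. by move=> /stabP pA /stabP pB; apply/stabP=> x; rewrite !inE pA pB. Qed.

Lemma stabI g A B : g \in stab A -> g \in stab B -> g \in stab (A :&: B).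
Proof. by move=> /stabP pA /stabP pB; apply/stabP=> x; rewrite !inE pA pB. Qed.

Lemma stabD g A B : g \in stab A -> g \in stab B -> g \in stab (A :\: B).
Proof. by move=> /stabP pA /stabP pB; apply/stabP=> x; rewrite !inE pA pB. Qed.

Lemma stabMr g A B : g \in stab B -> g \in stab (A * B).
Proof.
move=> /stabP pB; apply: sub_stab => _ /mulsgP[a b Aa Bb ->].
by rewrite -mulgA mem_mulg ?pB.
Qed.

Lemma stabMl g A B : g \in stab A -> g \in stab (A * B).
Proof. by rewrite sumsetC; apply: stabMr. Qed.

Lemma sub_stabM H A : H \subset stab (A * H).
Proof. by apply/subsetP=> h Hh; apply/stabMr/stabP=> x; rewrite groupMr. Qed.

Lemma lcoset_sub_stab H A x : H \subset stab A -> x \in A -> x *: H \subset A.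
Proof.
move=> /subsetP pA Ax; apply/subsetP=> _ /lcosetP[h Hh ->].
by have /stabP -> := pA _ Hh.
Qed.

Lemma mulg_stab A H : H \subset stab A -> A * H = A.
Proof.
move=> pA; apply/eqP; rewrite eqEsubset mulG_subl andbT.
apply/subsetP=> _ /mulsgP[a h Aa Hh ->].
by have /stabP -> := subsetP pA _ Hh.
Qed.

Lemma dvdn_stab H A : H \subset stab A -> (#|H| %| #|A|)%N.
Proof.
move=> pA; set P := rcosets H A.
have /and3P[_ /trivIsetS tP _] := rcosets_partition_mul [set: gT]%G H.
have {}tP : trivIset P by apply: tP; apply: imsetS; apply: subsetT.
have cP : cover P = A.
  rewrite -[RHS](mulg_stab pA) sumsetC; apply/setP=> x.
  apply/bigcupP/mulsgP=> [[_ /rcosetsP[a Aa ->] /rcosetP[h Hh ->]] | [h a Hh Aa ->]].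
    by exists h a.
  by exists (H :* a); [apply/rcosetsP; exists a | apply/rcosetP; exists h].
apply/dvdnP; exists #|P|; rewrite -{1}cP -(eqnP tP).
rewrite (eq_bigr (fun=> #|H|)) ?sum_nat_const //.
by move=> _ /rcosetsP[a _ ->]; rewrite card_rcoset.
Qed.

(** * Kneser's theorem *)

Lemma card_sum_mem A (P : pred gT) : (\sum_(x in A) P x = #|[set x in A | P x]|)%N.
Proof.
rewrite -sum1_card big_mkcond [RHS]big_mkcond; apply: eq_bigr => x _.
by rewrite inE; case: (x \in A); case: (P x).
Qed.

Lemma card_cosets_incidence H X Y :
  (\sum_(y in Y) #|X :&: y *: H| = \sum_(x in X) #|Y :&: x *: H|)%N.
Proof.
transitivity (\sum_(y in Y) \sum_(x in X) (x \in y *: H))%N.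
  by apply: eq_bigr => y _; rewrite card_sum_mem; apply: eq_card => x; rewrite !inE.
rewrite exchange_big /=; apply: eq_bigr => x _.
rewrite card_sum_mem; apply: eq_card => y; rewrite !inE; congr (_ && _).
by rewrite !mem_lcoset -groupV invMg invgK.
Qed.

Lemma card_translate_cap g x X H : g \in stab X ->
  #|X :&: (x * g) *: H| = #|X :&: x *: H|.
Proof.
move=> /stabP pX; rewrite -(card_rcoset (X :&: x *: H) g); apply: eq_card => y.
rewrite mem_rcoset !inE -{1}(mulgKV g y) pX !mem_lcoset; congr (_ && (_ \in H)).
by rewrite invMg (commG g^-1) -mulgA (commG g^-1).
Qed.

(** Inside a coset of H1 H2, every H1-coset meets every H2-coset in the same
    number of points, so an H1-periodic set and an H2-periodic set are
    independent for the uniform measure. *)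
Lemma card_periodic_cap (H1 H2 : {group gT}) c X Y :
  H1 \subset stab X -> H2 \subset stab Y ->
  X \subset c *: (H1 * H2) -> Y \subset c *: (H1 * H2) ->
  (#|X :&: Y| * #|(H1 * H2)%g| = #|X| * #|Y|)%N.
Proof.
move=> pX pY sX sY; set D := c *: (H1 * H2) in sX sY.
pose k := #|X :&: c *: H2|.
(* The H2-cosets of D are H1-translates of each other. *)
have kD y : y \in D -> #|X :&: y *: H2| = k.
  case/lcosetP=> _ /mulsgP[h1 h2 Hh1 Hh2 ->] ->.
  rewrite mulgA lcosetM (lcoset_id Hh2) card_translate_cap //.
  exact: (subsetP pX).
have count Z : H2 \subset stab Z -> Z \subset D -> (#|Z| * k = #|X :&: Z| * #|H2|)%N.
  move=> pZ sZ; rewrite -sum_nat_const -sum_nat_const.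
  rewrite (eq_bigr (fun y => #|X :&: y *: H2|)); last by move=> y Zy; rewrite kD ?(subsetP sZ).
  rewrite card_cosets_incidence (bigID (mem Z)) /=.
  rewrite [X in (_ + X)%N]big1 ?addn0 => [|x /andP[_ nZx]]; last first.
    apply/eqP; rewrite cards_eq0; apply/eqP/setP=> y; rewrite !inE.
    apply/negbTE; apply: contra nZx => /andP[Zy /lcosetP[h Hh y_xh]].
    by move/(subsetP pZ)/stabP: Hh => <-; rewrite -y_xh.
  apply: eq_big => [x|x /andP[_ Zx]]; first by rewrite inE.
  have /setIidPr -> := lcoset_sub_stab pZ Zx.
  by rewrite card_lcoset.
have cY := count Y pY sY.
have cD : (#|(H1 * H2)%g| * k = #|X| * #|H2|)%N.
  rewrite -(card_lcoset (H1 * H2) c) count ?(setIidPl sX) //.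
  by rewrite /D mulgA; apply: sub_stabM.
have H2_gt0 := cardG_gt0 H2.
nia.
Qed.

(** The combinatorial core of Kemperman's union lemma, on an n2 by n1 grid. If a
    union of s rows meets a union of t columns in fewer than n1 - 1 cells, and
    the complementary rows meet the complementary columns in fewer than n2 - 1
    cells, then the rows must be all of the n2 rows, and n2 < n1. *)
Lemma grid_cells (n1 n2 s t : nat) :
  (0 < s -> 0 < t -> s <= n2 -> s * t + 1 < n1 ->
   (n2 - s) * (n1 - t) + 1 < n2 -> n2 < n1)%N.
Proof.
move=> s0 t0 sn2 st1 st2.
case: (eqVneq s n2) => [e|ne]; first by subst s; nia.
have tn1 : (t < n1)%N by nia.
have [y' ey] : exists y' : nat, n2 = (s + y'.+1)%N by exists (n2 - s).-1; lia.
have [x' ex] : exists x' : nat, n1 = (t + x'.+1)%N by exists (n1 - t).-1; lia.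
by subst; nia.
Qed.

(** The same statement with cells of size k: m1 and m2 are the sizes of rows and
    columns, d is the size of the grid, x and x' count the points of a union of
    rows and of its complement, y and y' do so for columns. *)
Lemma grid_count (k m1 m2 d x x' y y' u v p q : nat) :
  (0 < k -> k %| m1 -> k %| m2 -> m1 * m2 = d * k ->
   m1 %| x -> m2 %| y -> 0 < x -> 0 < y -> x' + x = d -> y + y' = d ->
   u * d = x * y -> v * d = x' * y' -> u <= p -> v <= q ->
   p + k < m1 -> q + k < m2 -> m2 < m1)%N.
Proof.
move=> k0 /dvdnP[n1 e1] /dvdnP[n2 e2] ed /dvdnP[s es] /dvdnP[t et] x0 y0 ex ey eu ev up vq lt1 lt2.
have n10 : (0 < n1)%N by nia.
have n20 : (0 < n2)%N by nia.
have {}ed : (d = k * (n1 * n2))%N.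
  by apply/eqP; rewrite -(eqn_pmul2r k0) -ed e1 e2; apply/eqP; lia.
have s0 : (0 < s)%N by nia.
have t0 : (0 < t)%N by nia.
have sn2 : (s <= n2)%N.
  have : (s * (n1 * k) <= n2 * (n1 * k))%N by lia.
  by rewrite leq_pmul2r // muln_gt0 n10.
have tn1 : (t <= n1)%N.
  have : (t * (n2 * k) <= n1 * (n2 * k))%N by lia.
  by rewrite leq_pmul2r // muln_gt0 n20.
have d0 : (0 < d)%N by rewrite ed !muln_gt0 k0 n10.
have {}ex : (x' = (n2 - s) * (n1 * k))%N by rewrite mulnBl; lia.
have {}ey : (y' = (n1 - t) * (n2 * k))%N by rewrite mulnBl; lia.
have {}eu : (u = s * t * k)%N.
  by apply/eqP; rewrite -(eqn_pmul2r d0) eu es et ed e1 e2; apply/eqP; lia.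
have {}ev : (v = (n2 - s) * (n1 - t) * k)%N.
  by apply/eqP; rewrite -(eqn_pmul2r d0) ev ex ey ed; apply/eqP; lia.
have gt1 : (s * t + 1 < n1)%N.
  have : ((s * t + 1) * k < n1 * k)%N by lia.
  by rewrite ltn_pmul2r.
have gt2 : ((n2 - s) * (n1 - t) + 1 < n2)%N.
  have : (((n2 - s) * (n1 - t) + 1) * k < n2 * k)%N by lia.
  by rewrite ltn_pmul2r.
have := grid_cells s0 t0 sn2 gt1 gt2.
by rewrite e1 e2 ltn_pmul2r.
Qed.

(** The coset of H1 H2 through c is a grid with cells the cosets of H1 cap H2.  In
    it C2 is a union of H2-cosets and the complement of C1 a union of H1-cosets;
    both are non-empty because of c. *)
Lemma lt_stab_of_union_defect (C1 C2 : {set gT}) c (k := #|stab C1 :&: stab C2|) :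
  c \in C2 :\: C1 ->
  (#|C2 :\: C1| + k < #|stab C1| -> #|C1 :\: C2| + k < #|stab C2| ->
   #|stab C2| < #|stab C1|)%N.
Proof.
move=> /setDP[C2c nC1c] lt1 lt2.
set H1 := [group of stab C1] in lt1 *; set H2 := [group of stab C2] in lt2 *.
pose D := c *: (H1 * H2).
have pD1 : H1 \subset stab D by rewrite /D (sumsetC H1) mulgA; apply: sub_stabM.
have pD2 : H2 \subset stab D by rewrite /D mulgA; apply: sub_stabM.
have Dc : c \in D by rewrite mem_lcoset mulVg -[1]mulg1 mem_mulg.
have per (H : {group gT}) A B : H \subset stab A -> H \subset stab B ->
    (H \subset stab (A :&: B)) /\ (H \subset stab (A :\: B)).
  move=> /subsetP pA /subsetP pB.
  by split; apply/subsetP=> h Hh; [apply: stabI | apply: stabD]; auto.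
pose X := D :\: C1; pose Y := D :&: C2.
have [_ pX] := per _ _ _ pD1 (subxx _ : H1 \subset stab C1).
have [pY pY'] := per _ _ _ pD2 (subxx _ : H2 \subset stab C2).
have [pX' _] := per _ _ _ pD1 (subxx _ : H1 \subset stab C1).
have := card_periodic_cap pX pY (subsetDl _ _) (subsetIl _ _).
have := card_periodic_cap pX' pY' (subsetIl _ _) (subsetDl _ _).
have le1 : (#|(D :\: C1) :&: (D :&: C2)| <= #|C2 :\: C1|)%N.
  by apply/subset_leq_card/subsetP=> x; rewrite !inE => /andP[/andP[-> _] /andP[_ ->]].
have le2 : (#|(D :&: C1) :&: (D :\: C2)| <= #|C1 :\: C2|)%N.
  by apply/subset_leq_card/subsetP=> x; rewrite !inE => /andP[/andP[_ ->] /andP[-> _]].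
have X0 : (0 < #|D :\: C1|)%N by apply/card_gt0P; exists c; rewrite inE nC1c.
have Y0 : (0 < #|D :&: C2|)%N by apply/card_gt0P; exists c; rewrite inE C2c Dc.
have cD : #|D| = #|(H1 * H2)%g| by rewrite card_lcoset.
move=> cap' cap.
apply: (grid_count _ _ _ (mul_cardG H1 H2) (dvdn_stab pX) (dvdn_stab pY)
  X0 Y0 _ _ cap cap' le1 le2 lt1 lt2).
- exact: (cardG_gt0 [group of H1 :&: H2]).
- exact: (cardSg (subsetIl H1 H2)).
- exact: (cardSg (subsetIr H1 H2)).
- by rewrite -cD cardsID.
- by rewrite -cD cardsID.
Qed.

(** If neither set contains the other and the bound failed, then
    [lt_stab_of_union_defect] would apply with both orders of C1 and C2, so each
    of the two periods would be smaller than the other. *)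
Lemma kemperman_union (n : nat) (C1 C2 : {set gT}) :
  (n <= #|C1| + #|stab C1| -> n <= #|C2| + #|stab C2| ->
   n <= #|C1 :|: C2| + #|stab (C1 :|: C2)|)%N.
Proof.
move=> n1 n2.
have [s12|/subsetPn[c1 C1c1 nC2c1]] := boolP (C1 \subset C2); first by rewrite (setUidPr s12).
have [s21|/subsetPn[c2 C2c2 nC1c2]] := boolP (C2 \subset C1); first by rewrite (setUidPl s21).
have k_le : (#|stab C1 :&: stab C2| <= #|stab (C1 :|: C2)|)%N.
  by apply/subset_leq_card/subsetP=> g /setIP[p1 p2]; apply: stabU.
have cU1 : (#|C1 :|: C2| = #|C1| + #|C2 :\: C1|)%N.
  by have := cardsID C1 (C1 :|: C2); rewrite setUK setDUl setDv set0U.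
have cU2 : (#|C1 :|: C2| = #|C2| + #|C1 :\: C2|)%N.
  by have := cardsID C2 (C2 :|: C1); rewrite setUK setDUl setDv set0U setUC.
have g1 := @lt_stab_of_union_defect C1 C2 c2; rewrite inE C2c2 nC1c2 in g1.
have g2 := @lt_stab_of_union_defect C2 C1 c1; rewrite inE C1c1 nC2c1 in g2.
rewrite (setIC (stab C2)) in g2.
have {}g1 := g1 isT; have {}g2 := g2 isT.
by lia.
Qed.

(** Replace (A, B) by (A cup (g + B), B cap (A - g)) with g = e - b and e in A: the
    sum of the sizes is kept, the sumset does not grow, and a and b stay in their
    sets.  When no such move shrinks B, the set B - b consists of periods of A,
    and the translate A + b is the required C. *)
Lemma dyson_transform_bound A B a b : a \in A -> b \in B ->
  exists2 C : {set gT}, (C \subset A * B) && (a * b \in C) &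
    (#|A| + #|B| <= #|C| + #|stab C|)%N.
Proof.
have [n] := ubnP #|B|; elim: n => // n IHn in A B *.
move=> ltBn Aa Bb.
have [sBA | nsBA] := boolP [forall e in A, (b^-1 * e) *: B \subset A].
  exists (A :* b).
    rewrite mem_rcoset mulgK Aa andbT.
    by apply: mulgS; rewrite sub1set.
  rewrite card_rcoset leq_add2l -(card_lcoset B b^-1).
  apply/subset_leq_card/subsetP=> _ /lcosetP[x Bx ->].
  apply: sub_stab => _ /rcosetP[e Ae ->].
  rewrite mem_rcoset; apply: (subsetP (forall_inP sBA e Ae)).
  apply/lcosetP; exists x => //.
  by rewrite mulgA mulgK commG mulgA.
have {nsBA} [e Ae /subsetPn[z Bz nAz]] : exists2 e, e \in A & ~~ ((b^-1 * e) *: B \subset A).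
  by case/forallPn: nsBA => e; rewrite negb_imply => /andP[]; exists e.
set g := b^-1 * e in Bz; pose B' := B :&: g^-1 *: A; pose A' := A :|: g *: B.
have cAB : (#|A'| + #|B'| = #|A| + #|B|)%N.
  rewrite -(card_lcoset B g) -(card_lcoset B' g) -[RHS]cardsUI; congr addn; apply: eq_card => x.
  rewrite !inE !mem_lcoset !inE mem_lcoset invgK mulKVg andbC.
  by case: (x \in A).
have ltB : (#|B'| < #|B|)%N.
  rewrite proper_card // properEneq subsetIl andbT.
  apply: contraNneq nAz => eB; case/lcosetP: Bz => x; rewrite -eB => /setIP[_].
  by rewrite mem_lcoset invgK => ? ->.
have [|||C /andP[sC Cab] leC] := IHn A' B'.
- exact: leq_trans ltB _.
- by rewrite inE Aa.
- by rewrite inE Bb mem_lcoset invgK /g (commG _ e) mulgKV.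
exists C; last by rewrite -cAB.
rewrite Cab andbT; apply: subset_trans sC _.
apply/subsetP=> _ /mulsgP[x y /setUP[Ax|/lcosetP[b' Bb' ->]] /setIP[By gy] ->].
  exact: mem_mulg.
rewrite mem_lcoset invgK in gy.
by rewrite (commG g) -mulgA (commG b') mem_mulg.
Qed.

(** A maximal subset of A + B satisfying the bound is A + B itself, as it could
    otherwise be enlarged by a set given by [dyson_transform_bound]. *)
Lemma kneser_add_period A B : A != set0 -> B != set0 ->
  (#|A| + #|B| <= #|(A * B)%g| + #|stab (A * B)%g|)%N.
Proof.
move=> /set0Pn[a Aa] /set0Pn[b Bb].
pose P (C : {set gT}) := (C \subset A * B) && (#|A| + #|B| <= #|C| + #|stab C|)%N.
have [C0 /andP[sC0 _] leC0] := dyson_transform_bound Aa Bb.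
have [C /maxsetP[/andP[sC leC] maxC] _] := @maxset_exists _ P C0 (introT andP (conj sC0 leC0)).
suff <- : C = A * B by [].
apply/eqP; rewrite eqEsubset sC; apply/subsetP=> _ /mulsgP[x y Ax By ->].
have [C1 /andP[sC1 C1xy] leC1] := dyson_transform_bound Ax By.
rewrite -(maxC (C :|: C1)) ?subsetUl ?inE ?C1xy ?orbT //.
by rewrite /P subUset sC sC1 kemperman_union.
Qed.

(** Apply [kneser_add_period] to A + pi and B + pi, which have the same sumset. *)
Theorem kneser A B : A != set0 -> B != set0 ->
  (#|(A * stab (A * B))%g| + #|(B * stab (A * B))%g| <= #|(A * B)%g| + #|stab (A * B)%g|)%N.
Proof.
move=> nA nB; set H := [group of stab (A * B)].
have eAB : (A * H) * (B * H) = A * B.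
  have -> : (A * H) * (B * H) = (A * B) * H.
    by rewrite -mulgA (sumsetC B H) (mulgA H H) mulGid (sumsetC H) mulgA.
  exact: mulg_stab.
have nz C : C != set0 -> C * H != set0.
  by case/set0Pn=> x Cx; apply/set0Pn; exists (x * 1); apply: mem_mulg.
by have := kneser_add_period (nz _ nA) (nz _ nB); rewrite eAB.
Qed.

(** All four cardinals are multiples of the order of the period, so an upper
    bound with one unit to spare already forces equality. *)
Lemma kneser_sharp A B (L := [group of stab (A * B)]) : A != set0 -> B != set0 ->
  (#|(A * B)%g| < #|(A * L)%g| + #|(B * L)%g|)%N ->
  (#|(A * B)%g| + #|L| = #|(A * L)%g| + #|(B * L)%g|)%N.
Proof.
move=> nA nB; have L0 := cardG_gt0 L.
have : (#|(A * L)%g| + #|(B * L)%g| <= #|(A * B)%g| + #|L|)%N := kneser nA nB.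
have /dvdnP[a ->] : (#|L| %| #|(A * L)%g|)%N := dvdn_stab (sub_stabM L A).
have /dvdnP[b ->] : (#|L| %| #|(B * L)%g|)%N := dvdn_stab (sub_stabM L B).
have /dvdnP[s ->] : (#|L| %| #|(A * B)%g|)%N := dvdn_stab (subxx L).
rewrite -mulnDl -mulSnr leq_pmul2r // ltn_pmul2r // => le lt.
by congr (_ * _)%N; apply/eqP; rewrite eqn_leq le lt.
Qed.

(** * Groups of exponent two *)

Section Exponent2.
Hypothesis mulgg : forall x : gT, x * x = 1.

Lemma invgg x : x^-1 = x.
Proof. by apply: (mulgI x); rewrite mulgV mulgg. Qed.

Lemma mem_lcosetE2 x y A : (y \in x *: A) = (x * y \in A).
Proof. by rewrite mem_lcoset invgg. Qed.

Lemma mulgKK x y : x * (x * y) = y.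
Proof. by rewrite mulgA mulgg mul1g. Qed.

Lemma mulg_cancel x y z : (x * y) * (x * z) = y * z.
Proof. by rewrite (commG x y) -mulgA mulgKK. Qed.

Lemma mulACA x y z t : (x * y) * (z * t) = (x * z) * (y * t).
Proof. by rewrite -mulgA (mulgA y) (commG y z) !mulgA. Qed.

Lemma one_in_double A : A != set0 -> 1 \in A * A.
Proof. by case/set0Pn=> a Aa; rewrite -(mulgg a) mem_mulg. Qed.

Lemma lcoset_disjoint K a b : a * b \notin K -> [disjoint a *: K & b *: K].
Proof.
move=> nK; rewrite -setI_eq0; apply: contraNT nK => /set0Pn[x /setIP[]].
rewrite !mem_lcosetE2 => Ka Kb.
suff -> : a * b = (a * x) * (b * x) by rewrite groupM.
by rewrite (commG b) mulgA -(mulgA a) mulgg mulg1.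
Qed.

Lemma card_cap_disjoint S X Y : [disjoint X & Y] ->
  #|S :&: (X :|: Y)| = (#|S :&: X| + #|S :&: Y|)%N.
Proof.
move=> dXY; rewrite setIUr -cardsUI.
suff -> : S :&: X :&: (S :&: Y) = set0 by rewrite cards0 addn0.
by rewrite setIACA (disjoint_setI0 dXY) setI0.
Qed.

(** D misses at most |E| - |D| points of the two K-cosets contained in E. *)
Lemma two_fibres K (D E : {set gT}) a b :
    D \subset E -> K \subset stab E -> a \in E -> b \in E -> a * b \notin K ->
  (#|D| + 2 * #|K| <= #|D :&: a *: K| + #|D :&: b *: K| + #|E|)%N.
Proof.
move=> sDE pE Ea Eb /lcoset_disjoint dab.
have cup S := card_cap_disjoint S dab.
have := cup D; have := cup E.
rewrite (setIidPr (lcoset_sub_stab pE Ea)) (setIidPr (lcoset_sub_stab pE Eb)).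
rewrite !card_lcoset.
set T := a *: K :|: b *: K.
have := cardsID T D; have := cardsID T E.
have := subset_leq_card (setSD T sDE).
by card_lia.
Qed.

(** The set E cap (c + E) counts the representations of c in E + E.  Let H be the
    period of E + E.  If c is not in H, then c = a + b with a and b in different
    H-cosets; E has few holes in these cosets by Kneser, which produces more
    representations of c than allowed.  If c is in H, then E and c + E both lie in
    E + H; the bound on their intersection makes E + H a single coset. *)
Lemma few_representations_double_group (E : {set gT}) c :
  c \in E * E -> (#|(E * E)%g| + #|E :&: c *: E| <= 2 * #|E|)%N ->
  E * E = stab (E * E).
Proof.
case/mulsgP=> a b Ea Eb -> {c} leE; set c := a * b in leE *.
have nE : E != set0 by apply/set0Pn; exists a.
have E1 := one_in_double nE.
set H := [group of stab (E * E)].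
have kn : (2 * #|(E * H)%g| <= #|(E * E)%g| + #|H|)%N.
  by rewrite mul2n -addnn; apply: kneser.
have sE : E \subset E * H := mulG_subl H E.
have pE := sub_stabM H E.
have [Hc | nHc] := boolP (c \in H).
  have sU : E :|: c *: E \subset E * H.
    rewrite subUset sE; apply/subsetP=> x; rewrite mem_lcosetE2 => Ecx.
    by rewrite -(mulgKK c x) commG mem_mulg.
  have := cardsUI E (c *: E); rewrite card_lcoset.
  have := subset_leq_card sU => le1 eq1.
  have leH : (#|(E * H)%g| <= #|H|)%N by move: le1 eq1 leE kn; card_lia.
  have aH : a *: H = E * H.
    apply/eqP; rewrite eqEcard card_lcoset leH andbT.
    by apply: lcoset_sub_stab => //; apply: (subsetP sE).
  apply/eqP; rewrite eqEsubset; apply/andP; split.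
    apply/subsetP=> _ /mulsgP[x y /(subsetP sE) + /(subsetP sE) + ->].
    rewrite -aH !mem_lcosetE2 => Hx Hy.
    suff -> : x * y = (a * x) * (a * y) by exact: groupM.
    by rewrite (commG a x) -mulgA mulgKK.
  by have := lcoset_sub_stab (subxx _ : H \subset stab (E * E)) E1; rewrite mul1g.
have two := two_fibres sE pE (subsetP sE _ Ea) (subsetP sE _ Eb) nHc.
pose X := E :&: a *: H; pose Y := E :&: b *: H.
(* E at x and the translate by c of E at y lie in the same H-coset. *)
have half (x y : gT) (Z T : {set gT}) : x * y = c -> Z = E :&: x *: H -> T = E :&: y *: H ->
    (#|Z| + #|T| <= #|H| + #|(E :&: c *: E) :&: x *: H|)%N.
  move=> xyc eZ eT; rewrite -(card_lcoset T c) -cardsUI.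
  apply: leq_add.
    rewrite -(card_lcoset H x); apply/subset_leq_card.
    rewrite subUset eZ subsetIr; apply/subsetP=> z.
    by rewrite mem_lcosetE2 eT inE -xyc !mem_lcosetE2 (commG x) -mulgA mulgKK => /andP[].
  apply/subset_leq_card/subsetP=> z; rewrite eZ eT !inE !mem_lcosetE2 !inE.
  by case/and3P=> /andP[-> ->] ->.
have hX := half a b X Y erefl erefl erefl.
have hY := half b a Y X (commG b a) erefl erefl.
have sI : E :&: c *: E \subset E * H := subset_trans (subsetIl _ _) sE.
have dab := lcoset_disjoint nHc.
have hXY : (#|(E :&: c *: E) :&: a *: H| + #|(E :&: c *: E) :&: b *: H| <= #|E :&: c *: E|)%N.
  by rewrite -(card_cap_disjoint _ dab) subset_leq_card ?subsetIl.
have H0 := cardG_gt0 H.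
rewrite -/X -/Y in two.
by exfalso; move: two hX hY hXY leE kn H0; card_lia.
Qed.

(** * Sets of small doubling *)

Section Structure.
Variables (A : {set gT}) (e : gT).
Let H := [group of stab (A * A)].
Hypothesis HA : H \subset stab A.
Hypothesis doubling : (#|(A * A)%g| + #|H| = 2 * #|A|)%N.
Hypothesis AAe : e \in A * A.
Hypothesis nHe : e \notin H.

Let B := A :&: e *: A.
Let D := A :|: e *: A.
Let K := [group of stab (B * D)].
Let R := (A * A) :\: (B * D).

Let BD_sub : B * D \subset A * A.
Proof.
apply/subsetP=> _ /mulsgP[x y /setIP[Ax eAx] /setUP[Ay|eAy] ->]; first exact: mem_mulg.
rewrite !mem_lcosetE2 in eAx eAy.
by rewrite -(mulgKK e (x * y)) (mulgA e x) (commG e (e * x * y)) -mulgA (commG y) mem_mulg.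
Qed.

Let H_sub_K : H \subset K.
Proof.
apply/subsetP=> h Hh; apply/stabMl/stabI; first exact: (subsetP HA).
exact/stabMr/(subsetP HA).
Qed.

Let Ke : e \in K.
Proof.
apply/stabMl/sub_stab=> x; rewrite !inE !mem_lcosetE2 => /andP[Ax eAx].
by rewrite (commG x) eAx mulgKK.
Qed.

Let B_neq0 : B != set0.
Proof.
case/mulsgP: AAe => a b Aa Ab eab; apply/set0Pn; exists a.
by rewrite inE Aa mem_lcosetE2 eab (commG a) -mulgA mulgg mulg1.
Qed.

Let A_neq0 : A != set0.
Proof. by case/set0Pn: B_neq0 => x /setIP[Ax _]; apply/set0Pn; exists x. Qed.

Let D_neq0 : D != set0.
Proof. by case/set0Pn: A_neq0 => x Ax; apply/set0Pn; exists x; rewrite inE Ax. Qed.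

(** Otherwise e would be a period of 2A. *)
Let R_neq0 : R != set0.
Proof.
apply: contra nHe; rewrite setD_eq0 => sAB.
have eBD : B * D = A * A by apply/eqP; rewrite eqEsubset BD_sub.
by have := Ke; rewrite /= eBD.
Qed.

Let K_sub_BD : (K : {set gT}) \subset B * D.
Proof.
have [x Bx] := set0Pn _ B_neq0.
apply/subsetP=> k /stabP/(_ (x * x)); rewrite mulgg mul1g => ->.
by rewrite -(mulgg x) mem_mulg // inE; case/setIP: Bx => ->.
Qed.

Let DK : D * K = A * K.
Proof.
apply/eqP; rewrite eqEsubset (mulSg _ (subsetUl A _)) andbT.
apply/subsetP=> _ /mulsgP[x k /setUP[Ax|eAx] Kk ->]; first exact: mem_mulg.
rewrite mem_lcosetE2 in eAx.
by rewrite -(mulgKK e x) (commG e) -mulgA mem_mulg ?groupM.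
Qed.

Let D_sub_AK : D \subset A * K.
Proof. by rewrite -DK; apply: mulG_subl. Qed.

Let card_BD : (#|B| + #|D| = 2 * #|A|)%N.
Proof. by rewrite addnC cardsUI card_lcoset mul2n -addnn. Qed.

Let card_R : (#|(B * D)%g| + #|R| = #|(A * A)%g|)%N.
Proof. by rewrite -(cardsID (B * D) (A * A)) (setIidPr BD_sub). Qed.

(** As B + D lies in 2A, its size is less than 2|A| = |B| + |D|. *)
Let kneser_BD : (#|(B * D)%g| + #|K| = #|(B * K)%g| + #|(A * K)%g|)%N.
Proof.
have leB := subset_leq_card (mulG_subl K B).
have leD := subset_leq_card D_sub_AK.
have H0 := cardG_gt0 H.
have lt : (#|(B * D)%g| < #|(B * K)%g| + #|(A * K)%g|)%N.
  by move: leB leD card_BD card_R doubling H0; card_lia.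
by rewrite -DK in lt *; apply: kneser_sharp.
Qed.

Let holes : (#|(B * K)%g| + #|(A * K)%g| + #|H| + #|R| = #|K| + #|B| + #|D|)%N.
Proof. by move: kneser_BD card_R card_BD doubling; card_lia. Qed.

Let hR_le_K : (#|H| + #|R| <= #|K|)%N.
Proof.
have leB := subset_leq_card (mulG_subl K B).
have leD := subset_leq_card D_sub_AK.
by move: holes leB leD; card_lia.
Qed.

Section Pair.
Variables a b : gT.
Hypotheses (Aa : a \in A) (Ab : b \in A) (nBDab : a * b \notin B * D).

Let disjB : [disjoint B & a *: K].
Proof.
rewrite -setI_eq0; apply: contraNT nBDab => /set0Pn[x /setIP[Bx]].
rewrite mem_lcosetE2 => Kax.
have /stabP <- : a * x \in K by [].
suff -> : a * b * (a * x) = x * b by rewrite mem_mulg // inE Ab.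
by rewrite (commG a b) -mulgA mulgKK commG.
Qed.

(** B misses the coset a + K, since otherwise a + b would lie in B + D; so A and
    e + A are disjoint there, and they cover D. *)
Lemma pair_fibre : #|D :&: a *: K| = (2 * #|A :&: a *: K|)%N.
Proof.
have -> : D :&: a *: K = (A :&: a *: K) :|: e *: (A :&: a *: K).
  apply/setP=> x; rewrite !(in_setI, in_setU, in_setD, mem_lcosetE2).
  suff -> : (a * (e * x) \in K) = (a * x \in K) by rewrite -andb_orl.
  by rewrite mulgA (commG a e) -mulgA (groupMl _ Ke).
have := cardsUI (A :&: a *: K) (e *: (A :&: a *: K)).
rewrite card_lcoset mul2n -addnn => <-.
suff -> : (A :&: a *: K) :&: e *: (A :&: a *: K) = set0 by rewrite cards0 addn0.
apply/eqP; rewrite -subset0 -(eqP (_ : B :&: a *: K == set0)) ?setI_eq0 //.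
apply/subsetP=> x; rewrite !(in_setI, in_setU, in_setD, mem_lcosetE2).
by case/andP=> /andP[-> ->] /andP[->].
Qed.

Lemma pair_not_K : a * b \notin K.
Proof. by apply: contra nBDab => /(subsetP K_sub_BD). Qed.

End Pair.

(** D has at most |K| - |H| - |R| holes in the cosets of a and b, by [holes]. *)
Let pair_large a b : a \in A -> b \in A -> a * b \notin B * D ->
  (#|K| + #|H| + #|R| <= 2 * (#|A :&: a *: K| + #|A :&: b *: K|))%N.
Proof.
move=> Aa Ab nBD.
have nBD' : b * a \notin B * D by rewrite commG.
have sAK := subsetP (mulG_subl K A).
have := two_fibres D_sub_AK (sub_stabM K A) (sAK _ Aa) (sAK _ Ab) (pair_not_K nBD).
rewrite (pair_fibre Ab nBD) (pair_fibre Aa nBD') => two.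
have leB := subset_leq_card (mulG_subl K B).
by move: two leB holes; card_lia.
Qed.

Let mem_BD_K x k : k \in K -> (x * k \in B * D) = (x \in B * D).
Proof. by move=> /stabP. Qed.

(** If c = a + b, the translate by b of the fibre of A at a lies in R, and so does
    the translate by a of the fibre at b; the larger of them is bounded by
    [pair_large]. *)
Let R_large c : c \in R -> (#|K| + #|H| + #|R| <= 4 * #|R :&: c *: K|)%N.
Proof.
case/setDP=> /mulsgP[a b Aa Ab ->] nBD.
have sub x y : x \in A -> y \in A -> x * y = a * b ->
    (#|A :&: x *: K| <= #|R :&: (a * b) *: K|)%N.
  move=> Ax Ay xy; rewrite -(card_lcoset _ y); apply/subset_leq_card/subsetP=> z.
  rewrite !(in_setI, in_setU, in_setD, mem_lcosetE2) => /andP[Ayz Kxyz].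
  have Kabz : a * b * z \in K by rewrite -xy -mulgA.
  rewrite Kabz andbT -{2}(mulgKK y z) mem_mulg // andbT.
  by rewrite -(mem_BD_K _ Kabz) commG -mulgA mulgg mulg1.
have := pair_large Aa Ab nBD.
have := sub a b Aa Ab erefl; have := sub b a Ab Aa (commG b a).
by card_lia.
Qed.

(** Two different cosets would each contain more than half of R, because
    |R| < |K| + |H| by [hR_le_K]. *)
Let R_coset c : c \in R -> R \subset c *: K.
Proof.
move=> Rc; apply/subsetP=> c' Rc'; rewrite mem_lcosetE2.
have [//|nK] := boolP (c * c' \in K).
have dK := lcoset_disjoint nK.
have := R_large Rc; have := R_large Rc'.
have := subset_leq_card (subsetIl R (c *: K :|: c' *: K)).
rewrite (card_cap_disjoint _ dK).
have H0 := cardG_gt0 H.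
by move: hR_le_K H0; card_lia.
Qed.

Section MissingCoset.
Variable c : gT.
Hypothesis Rc : c \in R.
Let C := (c *: K) :\: R.

Let card_C : (#|C| + #|R| = #|K|)%N.
Proof. by rewrite -(card_lcoset K c) -(cardsID R (c *: K)) (setIidPr (R_coset Rc)) addnC. Qed.

Let cK_BD x : x \in c *: K -> x \notin B * D.
Proof.
rewrite mem_lcosetE2 => Kcx; rewrite -(mem_BD_K _ Kcx) commG -mulgA mulgg mulg1.
by case/setDP: Rc.
Qed.

Let AA_C : A * A = (B * D :|: c *: K) :\: C.
Proof.
apply/setP=> x; have := subsetP BD_sub x; have := subsetP (R_coset Rc) x.
have := @cK_BD x; rewrite !(in_setI, in_setU, in_setD).
case: (x \in c *: K); case: (x \in B * D); case: (x \in A * A) => //= h1 h2 h3.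
all: by first [have := h1 isT | have := h2 isT | have := h3 isT].
Qed.

Let C_not_AA x : x \in C -> x \notin A * A.
Proof. by move=> Cx; rewrite AA_C in_setD Cx. Qed.

Let C_neq0 : C != set0.
Proof.
apply: contra nHe => /eqP C0; rewrite /H /= AA_C C0 setD0.
by apply: stabU; [apply: Ke | apply: (subsetP (sub_stabM K _))].
Qed.

(** Let X and Y be the fibres of A at a and b.  The sum X + C lies in the coset
    b + K and avoids Y, so |X + C| <= |K| - |Y|, which by [pair_large] is less than
    |X| + |C|/2.  If C met two cosets of L = pi(X + C), then |L| <= |C + L|/2, and
    Kneser's theorem would give |X + C| >= |X| + |C|/2. *)
Let C_stab a b y1 y2 : a \in A -> b \in A -> a * b \in c *: K ->
  y1 \in C -> y2 \in C -> y1 * y2 \in stab ((A :&: a *: K) * C).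
Proof.
move=> Aa Ab cKab Cy1 Cy2; have nBD := cK_BD cKab.
have large := pair_large Aa Ab nBD.
set X := A :&: a *: K in large *; set Y := A :&: b *: K in large.
have X_neq0 : X != set0.
  by apply/set0Pn; exists a; rewrite inE Aa mem_lcosetE2 mulgg group1.
have room : (#|(X * C)%g| + #|Y| <= #|K|)%N.
  rewrite -(card_lcoset K b) -(setIidPr (_ : X * C \subset b *: K)); last first.
    apply/subsetP=> _ /mulsgP[x y /setIP[_ +] /setDP[+ _] ->].
    move: cKab; rewrite !mem_lcosetE2 => Kcab Kax Kcy.
    suff -> : b * (x * y) = (c * (a * b)) * (a * x) * (c * y) by rewrite groupM // groupM.
    by rewrite -(mulgA c (a * b)) !mulg_cancel mulgA.
  have dXC : [disjoint b *: K :&: (X * C) & Y].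
    apply/pred0P=> z /=; apply/negbTE/negP=> /andP[/setIP[_ +] /setIP[Az _]].
    case/mulsgP=> x y /setIP[Ax _] Cy ez; rewrite ez in Az.
    by move/C_not_AA: Cy; rewrite -(mulgKK x y) mem_mulg.
  rewrite -cardsUI (disjoint_setI0 dXC) cards0 addn0.
  by apply/subset_leq_card; rewrite subUset subsetIl subsetIr.
pose L := [group of stab (X * C)].
have kn : (#|(X * L)%g| + #|(C * L)%g| <= #|(X * C)%g| + #|L|)%N := kneser X_neq0 C_neq0.
have leX := subset_leq_card (mulG_subl L X).
have leC := subset_leq_card (mulG_subl L C).
have /dvdnP[m em] : (#|L| %| #|(C * L)%g|)%N := dvdn_stab (sub_stabM L C).
have H0 := cardG_gt0 H; have L0 := cardG_gt0 L.
have m1 : (m <= 1)%N.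
  rewrite leqNgt; apply/negP=> m2.
  have leL : (2 * #|L| <= #|(C * L)%g|)%N by rewrite em leq_pmul2r.
  by move: leL kn room leX leC large card_C H0; card_lia.
have CL : y1 *: L = C * L.
  apply/eqP; rewrite eqEcard card_lcoset em -{2}(mul1n #|L|) leq_pmul2r // m1 andbT.
  by apply: lcoset_sub_stab (sub_stabM L C) _; apply: (subsetP (mulG_subl L C)).
by have := subsetP (mulG_subl L C) _ Cy2; rewrite -CL mem_lcosetE2.
Qed.

(** If x = a + b is in 2A but y3 = x + y1 + y2 is not, then y3 is in C, and
    b = a + x = a + y1 + (y2 + y3) belongs to the sum of C and the fibre of A at a,
    by [C_stab].  This sum avoids A. *)
Let C_diff_period y1 y2 : y1 \in C -> y2 \in C -> y1 * y2 \in H.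
Proof.
move=> Cy1 Cy2; apply: sub_stab => x AAx.
have K12 : y1 * y2 \in K.
  move: Cy1 Cy2 => /setDP[+ _] /setDP[+ _]; rewrite !mem_lcosetE2 => K1 K2.
  suff -> : y1 * y2 = (c * y1) * (c * y2) by rewrite groupM.
  by rewrite (commG c y1) -mulgA mulgKK.
have [BDx | nBDx] := boolP (x \in B * D).
  by apply: (subsetP BD_sub); rewrite mem_BD_K.
have cKx : x \in c *: K by apply: (subsetP (R_coset Rc)); rewrite inE nBDx.
apply: contraLR AAx => nAA; apply/mulsgP=> -[a b Aa Ab eab].
have Cy3 : x * (y1 * y2) \in C.
  rewrite !(in_setI, in_setU, in_setD) (negbTE nAA) andbF /=.
  by move: cKx; rewrite !mem_lcosetE2 mulgA => Kcx; rewrite groupM.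
have cKab : a * b \in c *: K by rewrite -eab.
set y3 := x * (y1 * y2) in Cy3.
have Xa : a \in A :&: a *: K by rewrite inE Aa mem_lcosetE2 mulgg group1.
have /stabP/(_ (a * y1)) := C_stab Aa Ab cKab Cy2 Cy3.
rewrite (mem_mulg Xa Cy1) => /mulsgP[x' y /setIP[Ax' _] Cy e1].
have eb : b = x' * y.
  by rewrite -e1 /y3 eab -mulgA (mulgA y1) (commG (a * b)) !mulgKK.
by move/C_not_AA: Cy; rewrite -(mulgKK x' y) -eb mem_mulg.
Qed.

Let C_coset y : y \in C -> C = y *: H.
Proof.
move=> Cy; apply/eqP; rewrite eqEsubset; apply/andP; split.
  by apply/subsetP=> x Cx; rewrite mem_lcosetE2; apply: C_diff_period.
apply: lcoset_sub_stab Cy; apply/subsetP=> h Hh.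
have pBD : h \in stab (B * D) := subsetP H_sub_K _ Hh.
apply: stabD; last exact: stabD.
exact: (subsetP (sub_stabM K [set c]) _ pBD).
Qed.

Let E := A * K.

Let EE : E * E = B * D :|: c *: K.
Proof.
have eEE : E * E = (A * A) * K.
  by rewrite /E -mulgA (mulgA K A) (sumsetC K) -(mulgA A K) mulGid mulgA.
apply/eqP; rewrite eqEsubset eEE; apply/andP; split.
  apply/subsetP=> _ /mulsgP[x k AAx Kk ->]; rewrite in_setU (mem_BD_K _ Kk).
  have [//|nBDx] := boolP (x \in B * D).
  have : x \in c *: K by apply: (subsetP (R_coset Rc)); rewrite in_setD nBDx.
  by rewrite !mem_lcosetE2 mulgA => cKx; rewrite groupM.
rewrite subUset (subset_trans BD_sub (mulG_subl K _)) mulSg // sub1set.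
by case/setDP: Rc.
Qed.

(** If both x and c + x are in E, then x is not in B + K, since c would be in
    (B + K) + (A + K) = B + D.  So c has at most |E| - |B + K| representations, and
    |2E| = |B + D| + |K| = |B + K| + |E|. *)
Let EE_group : E * E = stab (E * E).
Proof.
apply: (@few_representations_double_group E c).
  by rewrite EE in_setU mem_lcosetE2 mulgg group1 orbT.
have cardEE : #|(E * E)%g| = (#|(B * D)%g| + #|K|)%N.
  rewrite EE -(card_lcoset K c) -cardsUI.
  suff -> : B * D :&: c *: K = set0 by rewrite cards0 addn0.
  apply/setP=> x; rewrite in_setI in_set0 andbC; apply/negP=> /andP[/cK_BD].
  by case: (x \in B * D).
have disj : [disjoint E :&: c *: E & B * K].
  rewrite -setI_eq0 -subset0; apply/subsetP=> x /setIP[/setIP[_ +] /mulsgP[b k Bb Kk ex]].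
  rewrite mem_lcosetE2 => /mulsgP[a k' Aa Kk' ecx].
  have ec : c = (b * a) * (k * k').
    rewrite -[LHS]mulg1 -(mulgg x) mulgA ecx ex commG -(mulgA b k) (mulgA k a) (commG k a).
    by rewrite -(mulgA a k) mulgA.
  case/setDP: Rc => _ /negP[]; rewrite ec mem_BD_K ?groupM //.
  by rewrite mem_mulg // in_setU Aa.
have sub : (E :&: c *: E) :|: B * K \subset E.
  by rewrite subUset subsetIl mulSg ?subsetIl.
have := subset_leq_card sub; rewrite cardsU (disjoint_setI0 disj) cards0 subn0.
by move: cardEE kneser_BD; rewrite -/E; card_lia.
Qed.

Lemma structure_at_missing : exists (F : {group gT}) z, z *: H \subset F /\ A * A = F :\: z *: H.
Proof.
have [y Cy] := set0Pn _ C_neq0.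
exists [group of stab (E * E)], y; rewrite -(C_coset Cy) /= -EE_group EE; split.
  exact: subset_trans (subsetDl _ _) (subsetUr _ _).
exact: AA_C.
Qed.

End MissingCoset.

Lemma structure_periodic : exists (F : {group gT}) z, z *: H \subset F /\ A * A = F :\: z *: H.
Proof. by have [c Rc] := set0Pn _ R_neq0; apply: structure_at_missing Rc. Qed.

End Structure.

Lemma sumset_stab A (H := stab (A * A)) : (A * H) * (A * H) = A * A.
Proof.
have -> : (A * H) * (A * H) = (A * A) * H.
  by rewrite -mulgA (mulgA H A) (sumsetC H) -(mulgA A H) mulGid mulgA.
exact: mulg_stab.
Qed.

(** The alternative 2A = H means that A lies in one coset of its period H; in the
    other one, [structure_periodic] is applied to A + H. *)
Theorem small_doubling (A : {set gT}) (H := [group of stab (A * A)]) :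
  (#|(A * A)%g| < 2 * #|A|)%N ->
  (#|(A * A)%g| + #|H| = 2 * #|(A * H)%g|)%N /\
  (A * A = H \/ exists (F : {group gT}) z, z *: H \subset F /\ A * A = F :\: z *: H).
Proof.
move=> lt; have A_neq0 : A != set0.
  by apply: contraTneq lt => ->; rewrite cards0 muln0 ltn0.
have eAA := sumset_stab A; rewrite -/H in eAA.
have dbl : (#|(A * A)%g| + #|H| = 2 * #|(A * H)%g|)%N.
  rewrite mul2n -addnn; apply: kneser_sharp => //.
  have le : (#|A| <= #|(A * H)%g|)%N := subset_leq_card (mulG_subl H A).
  by apply: leq_trans lt _; rewrite mul2n -addnn leq_add.
split=> //.
have [sAH | /subsetPn[e AAe nHe]] := boolP (A * A \subset H).
  left; apply/eqP; rewrite eqEsubset sAH.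
  by have := lcoset_sub_stab (subxx H) (one_in_double A_neq0); rewrite mul1g.
right.
have := @structure_periodic (A * H) e; rewrite eAA; apply => //.
  exact: sub_stabM.
Qed.

(** * Antisymmetric sets and trimmed shifts *)

Lemma card_mulg_TI (F H : {group gT}) S : S \subset F -> F :&: H = 1 ->
  #|(S * H)%g| = (#|S| * #|H|)%N.
Proof.
move=> /subsetP sSF tiFH; rewrite -cardsX.
have -> : S * H = [set u.1 * u.2 | u in setX S H].
  apply/setP=> x; apply/mulsgP/imsetP=> [[s h Ss Hh ->] | [[s h] /setXP[Ss Hh] ->]].
    by exists (s, h) => //; apply/setXP.
  by exists s h.
rewrite card_in_imset // => -[s h] [s' h'] /setXP[/= Ss Hh] /setXP[/= Ss' Hh'] e.
have es : s * s' = h' * h by rewrite -(mulg_cancel h) (commG h s) (commG h s') e mulg_cancel.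
have : s * s' \in F :&: H by rewrite inE {2}es !groupM ?sSF.
rewrite tiFH inE => /eqP s1; have ss : s = s' by rewrite -(mulgKK s s') s1 mulg1.
by move: e; rewrite ss => /mulgI ->.
Qed.

Section Antisymmetric.
Variables (F : {group gT}) (h0 : gT) (S : {set gT}).
Hypothesis Fh0 : h0 \in F.
Hypothesis FE : (F : {set gT}) = S :|: h0 *: S.
Hypothesis disjS : [disjoint S & h0 *: S].

Let sSF : S \subset F.
Proof. by rewrite FE subsetUl. Qed.

Lemma antisymmetric_mem x : x \in F -> (h0 * x \in S) = (x \notin S).
Proof.
move=> Fx; have := Fx; rewrite FE in_setU mem_lcosetE2.
have := disjointFr disjS; move=> /(_ x); rewrite mem_lcosetE2.
by case: (x \in S) => [->|_ //].
Qed.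

Lemma antisymmetric_neq0 : S != set0.
Proof.
apply: contraTneq (group1 F) => S0.
by rewrite FE S0 mulg0 setU0 inE.
Qed.

Lemma antisymmetric_card : #|F| = (2 * #|S|)%N.
Proof.
have := cardsU S (h0 *: S); rewrite -FE (disjoint_setI0 disjS) cards0 subn0.
by rewrite card_lcoset addnn -mul2n.
Qed.

Lemma stab_subset : stab S \subset F.
Proof.
have [s Ss] := set0Pn _ antisymmetric_neq0.
apply/subsetP=> g /stabP/(_ s); rewrite Ss => Ssg.
by rewrite -(mulgKK s g) groupM ?(subsetP sSF).
Qed.

(** If h0 + x is not a period of S, some s in S has s + h0 + x outside S, and then
    s + x is in S by antisymmetry, so x = s + (s + x). *)
Lemma antisymmetric_sumset : S * S = F :\: h0 *: stab S.
Proof.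
have sF := subsetP sSF.
apply/setP=> x; rewrite in_setD mem_lcosetE2; apply/mulsgP/andP=> [[s t Ss St ->] | [nst Fx]].
  split; last by rewrite groupM ?sF.
  apply: contraL (St) => /stabP/(_ s); rewrite Ss => Sst.
  rewrite -antisymmetric_mem ?sF //.
  by rewrite -(mulgKK s (h0 * t)) (mulgA s h0) (commG s h0) -(mulgA h0 s).
have /subsetPn[_ /rcosetP[s Ss ->] nS] : ~~ (S :* (h0 * x) \subset S).
  apply: contra nst => sS; apply: sub_stab => s Ss; apply: (subsetP sS).
  by rewrite mem_rcoset mulgK.
exists s (s * x); rewrite ?mulgKK //.
have Fs := sF _ Ss.
rewrite -(mulgKK h0 (s * x)) antisymmetric_mem ?groupM //.
by rewrite mulgA (commG h0) -mulgA.
Qed.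

Lemma antisymmetric_sumset_card : #|(S * S)%g| = (#|F| - #|stab S|)%N.
Proof.
rewrite antisymmetric_sumset cardsD (setIidPr _) ?card_lcoset //.
by rewrite mul_subG // ?sub1set // stab_subset.
Qed.

Variable H : {group gT}.
Hypothesis tiFH : F :&: H = 1.
Variables (A : {set gT}) (g : gT).
Hypothesis sA : A \subset g *: (S * H).
Hypothesis few : (2 * #|(g *: (S * H)) :\: A| < #|H|)%N.

(** For x in s + t + H, adding x exchanges the cosets of g + s and g + t.  If no a in
    A over s had x + a in A, then this coset would be covered by the removed
    elements and by a translate of them, which are too few. *)
Lemma trimmed_sumset : A * A = (S * S) * H.
Proof.
apply/eqP; rewrite eqEsubset; apply/andP; split.
  apply/subsetP=> _ /mulsgP[a b /(subsetP sA) + /(subsetP sA) + ->].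
  rewrite !mem_lcosetE2 => /mulsgP[s h Ss Hh ea] /mulsgP[t k St Hk eb].
  by rewrite -(mulg_cancel g) ea eb mulACA mem_mulg ?groupM // mem_mulg.
apply/subsetP=> _ /mulsgP[_ h /mulsgP[s t Ss St ->] Hh ->].
pose x := s * t * h; pose T := g *: (S * H).
have fewT : (2 * #|T :\: A| < #|H|)%N := few; rewrite -/x.
pose P := (g * s) *: H.
have /subsetPn[a Pa] : ~~ (P \subset (T :\: A) :|: x *: (T :\: A)).
  apply: contraL fewT => /subset_leq_card; rewrite card_lcoset -leqNgt => /leq_trans-> //.
  by rewrite cardsU card_lcoset addnn -mul2n leq_subr.
rewrite in_setU mem_lcosetE2 !in_setD negb_or !negb_and !negbK.
have mT u k : u \in S -> k \in H -> g * (u * k) \in T.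
  by move=> Su Hk; rewrite mem_lcoset mulKg mem_mulg.
case/lcosetP: Pa => k Hk ->.
rewrite -(mulgA g s k) mT // orbF.
have ex : x * (g * (s * k)) = g * (t * (h * k)).
  by rewrite mulgA (commG x g) -mulgA /x -(mulgA s t) mulg_cancel -mulgA.
rewrite ex mT ?groupM // orbF => /andP[A1 A2].
by rewrite -(mulgKK (g * (s * k)) x) mem_mulg // commG ex.
Qed.

Lemma trimmed_sumset_card : #|(A * A)%g| = ((#|F| - #|stab S|) * #|H|)%N.
Proof.
rewrite trimmed_sumset (@card_mulg_TI F) ?antisymmetric_sumset_card //.
by rewrite mul_subG.
Qed.

Lemma trimmed_small_doubling : ((#|F| - #|stab S|) * #|H| < 2 * #|A|)%N.
Proof.
have := cardsID A (g *: (S * H)); rewrite (setIidPr sA) card_lcoset (@card_mulg_TI F) // => cA.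
have cF := antisymmetric_card.
have st : (0 < #|stab S|)%N := cardG_gt0 [group of stab S].
have le : ((#|F| - #|stab S|) * #|H| <= 2 * (#|S| * #|H|) - #|H|)%N.
  by rewrite mulnA -[X in (_ <= _ - X)%N]mul1n -mulnBl leq_mul2r cF leq_sub2l ?orbT.
have leH : (#|H| <= #|S| * #|H|)%N.
  by rewrite -{1}(mul1n #|H|) leq_mul2r card_gt0 antisymmetric_neq0 orbT.
by apply: leq_ltn_trans le _; move: few leH; rewrite -cA; card_lia.
Qed.

Lemma trimmed_aperiodic_sumset : stab S = 1 -> A * A = (F * H) :\: h0 *: H.
Proof.
move=> S1; rewrite trimmed_sumset antisymmetric_sumset S1 mulg1.
apply/setP=> x; rewrite in_setD mem_lcosetE2.
apply/mulsgP/andP=> [[f h /setDP[Ff nf] Hh ->] | [nH /mulsgP[f h Ff Hh ex]]].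
  split; last exact: mem_mulg.
  rewrite mulgA groupMr //; apply: contra nf => Hf.
  have : h0 * f \in F :&: H by rewrite inE Hf groupM.
  by rewrite tiFH !inE => /eqP e; rewrite -(mulgKK h0 f) e mulg1.
exists f h => //; rewrite in_setD Ff andbT inE.
by apply: contra nH => /eqP e; rewrite ex e mulgA mulgg mul1g.
Qed.

End Antisymmetric.

Lemma abelem_exponent2 (G : {group gT}) : 2.-abelem G.
Proof.
rewrite abelemE //; apply/andP; split; first by apply/centsP=> x _ y _; apply: commG.
by apply/exponentP=> x _; rewrite expgS expg1 mulgg.
Qed.

(** * Classification *)

Lemma pow2_ge8 (n s : nat) :
  (2 * s = 2 ^ n -> s != 1 -> s != 2 -> 8 <= 2 * s)%N.
Proof.
move=> e /eqP s1 /eqP s2.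
case: n e => [|[|[|n]]]; rewrite ?expnS; [lia|lia|lia|].
by have := expn_gt0 2 n; lia.
Qed.

(** In the second alternative of [small_doubling], 2A is a subgroup F1 minus a coset
    z + H.  A complement F of H in F1 meets the shift a + (A + H) in a set S with
    S + H = a + (A + H), hence |F| = 2|S|; the element h0 of F in z + H is not a
    difference of elements of S, as it is not in 2A.  The order of F is a power of
    two; |F| = 2 would make A + H one coset and give 2A = H, and for |F| = 4 the
    set S has two elements, whose sum is a period of S. *)
Theorem small_doubling_classification A : (#|(A * A)%g| < 2 * #|A|)%N ->
  (exists (H : {group gT}) g, A \subset g *: H /\ (#|H| < 2 * #|A|)%N) \/
  exists (F H : {group gT}) S h0 g,
    [/\ (8 <= #|F|)%N, F :&: H = 1,
        [&& h0 \in F, h0 != 1, S \subset F,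
            (F : {set gT}) == S :|: h0 *: S & [disjoint S & h0 *: S]],
        stab S = 1 &
        A \subset g *: (S * H) /\ (2 * #|(g *: (S * H)) :\: A| < #|H|)%N].
Proof.
move=> lt; have [] := small_doubling lt.
set H := [group of stab (A * A)] => dbl.
have /set0Pn[a Aa] : A != set0.
  by apply: contraTneq lt => ->; rewrite cards0 muln0 ltn0.
have sAA : A \subset a *: (A * A).
  by apply/subsetP=> x Ax; rewrite mem_lcosetE2 mem_mulg.
have [eAA _ | nAA [/eqP|[F1 [z [szF eAA]]]]] := eqVneq (A * A) H.
- left; exists H, a; have cH : #|(A * A)%g| = #|H| := congr1 (fun X : {set gT} => #|X|) eAA.
  by rewrite -cH; split=> //; rewrite -[X in _ *: X]eAA.
- by rewrite (negbTE nAA).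
right.
have F1z : z \in F1 by apply: (subsetP szF); rewrite mem_lcosetE2 mulgg group1.
have sHF : H \subset F1.
  apply/subsetP=> h Hh; rewrite -(groupMl _ F1z); apply: (subsetP szF).
  by rewrite mem_lcosetE2 mulgKK.
have /splitsP[F /complP[tiHF eHF]] := abelem_splits (abelem_exponent2 F1) sHF.
have tiFH : F :&: H = 1 by rewrite setIC.
have eFH : F * H = F1 by rewrite sumsetC.
pose T := a *: (A * H); pose S := F :&: T.
have sAAF : A * A \subset F1 by rewrite eAA subsetDl.
have sTF : T \subset F1.
  rewrite /T mulgA mul_subG //; apply: subset_trans sAAF.
  by apply: mulSg; rewrite sub1set.
have pT : H \subset stab T by rewrite /T mulgA; apply: sub_stabM.
have memT x h : h \in H -> (x * h \in T) = (x \in T) by move/(subsetP pT)/stabP.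
have eSH : S * H = T.
  apply/eqP; rewrite eqEsubset; apply/andP; split.
    by apply/subsetP=> _ /mulsgP[s h /setIP[_ Ts] Hh ->]; rewrite memT.
  apply/subsetP=> x Tx; have := subsetP sTF _ Tx; rewrite -eFH => /mulsgP[f h Ff Hh ex].
  by rewrite ex mem_mulg // inE Ff -(memT _ _ Hh) -ex.
have cF1 : #|F1| = (#|F| * #|H|)%N by rewrite -eFH TI_cardMg.
have sSF : S \subset F := subsetIl _ _.
have cT : #|T| = (#|S| * #|H|)%N by rewrite -eSH (@card_mulg_TI F).
have cAH : #|T| = #|(A * H)%g| by rewrite card_lcoset.
have H0 := cardG_gt0 H.
have cF : #|F| = (2 * #|S|)%N.
  have cAA : (#|(A * A)%g| + #|H| = #|F1|)%N.
    by rewrite eAA cardsD (setIidPr szF) card_lcoset subnK // -(card_lcoset H z) subset_leq_card.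
  apply/eqP; rewrite -(eqn_pmul2r H0) -cF1 -mulnA -cT cAH; apply/eqP.
  by move: cAA dbl; card_lia.
have TT x y : x \in T -> y \in T -> x * y \in A * A.
  rewrite !mem_lcosetE2 => /mulsgP[b h Ab Hh eb] /mulsgP[b' h' Ab' Hh' eb'].
  have -> : x * y = (b * b') * (h * h').
    by rewrite -(mulg_cancel a) eb eb' -mulgA (mulgA h) (commG h b') -!mulgA.
  have /stabP -> : h * h' \in H by rewrite groupM.
  exact: mem_mulg.
have [h0 Fh0 zh0] : exists2 h0, h0 \in F & h0 \in z *: H.
  move: F1z; rewrite -eFH => /mulsgP[f h Ff Hh ez]; exists f => //.
  by rewrite mem_lcosetE2 ez (commG f) -mulgA mulgg mulg1.
have nh0 : h0 \notin A * A by rewrite eAA in_setD zh0.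
have h0_neq1 : h0 != 1.
  by apply: contraNneq nh0 => ->; apply: one_in_double; apply/set0Pn; exists a.
have disjS : [disjoint S & h0 *: S].
  rewrite -setI_eq0; apply: contraNT nh0 => /set0Pn[x /setIP[/setIP[_ Tx]]].
  rewrite mem_lcosetE2 => /setIP[_ Thx].
  by have := TT _ _ Tx Thx; rewrite (commG h0) mulgKK.
have FE : (F : {set gT}) = S :|: h0 *: S.
  apply/eqP; rewrite eq_sym eqEcard cardsU (disjoint_setI0 disjS) cards0 subn0.
  rewrite card_lcoset addnn -mul2n cF leqnn andbT subUset sSF.
  by rewrite mul_subG // sub1set.
have eAH : a *: (S * H) = A * H.
  by rewrite eSH; apply/setP=> x; rewrite !mem_lcosetE2 mulgKK.
have S1 : stab S = 1.
  apply/eqP; rewrite eqEsubset sub1G andbT -tiFH subsetI (stab_subset FE) /=.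
  apply/subsetP=> x Sx; rewrite -(sumset_stab A) -/H -eAH.
  by apply/stabMl/stabMr/stabMl.
have F8 : (8 <= #|F|)%N.
  have pF := abelem_pgroup (abelem_exponent2 F).
  rewrite cF; apply: (@pow2_ge8 (logn 2 #|F|)); first by rewrite -cF -(card_pgroup pF).
    apply: contraNneq nAA => S1'.
    have le : (#|(A * A)%g| <= #|H|)%N by move: dbl; rewrite -cAH cT S1'; card_lia.
    rewrite eq_sym eqEcard le andbT.
    have := lcoset_sub_stab (subxx H) (_ : 1 \in A * A); rewrite mul1g; apply.
    by apply: one_in_double; apply/set0Pn; exists a.
  apply/negP=> /cards2P[s [t [st eS]]].
  have /set1P st1 : s * t \in [1 gT].
    rewrite -S1; apply: sub_stab => x; rewrite eS !inE.
    by case/orP=> /eqP ->; rewrite ?mulgKK ?(commG s) ?mulgKK eqxx ?orbT.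
  by case/eqP: st; rewrite -(mulgKK s t) st1 mulg1.
exists F, H, S, h0, a; split=> //.
  by rewrite Fh0 h0_neq1 sSF FE eqxx disjS.
rewrite eAH mulG_subl; split=> //.
have := cardsID A (A * H); rewrite (setIidPr (mulG_subl H A)).
by move: dbl lt; card_lia.
Qed.

End Exponent2.
End AbelianGroup.

(** * Vector spaces over the field with two elements *)

Lemma rVF2_sq r (x : 'rV['F_2]_r) : (x * x = 1)%g.
Proof. by apply/rowP=> i; rewrite !mxE (addrr_pchar2 (pchar_Fp _)). Qed.

Theorem theorem5 (r : nat) (hr : (1 <= r)%N) :
  (forall A : {set 'rV['F_2]_r}, (#|(A * A)%g| < 2 * #|A|)%N ->
     (dense_in_coset A
      \/ exists (F H : {group 'rV['F_2]_r}) (S : {set 'rV['F_2]_r}),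
           antisymmetric_structure F H S A)
     /\ (forall (F H : {group 'rV['F_2]_r}) (S : {set 'rV['F_2]_r}),
           antisymmetric_structure F H S A ->
           (exists2 c : 'rV['F_2]_r, c \in (F * H)%g
              & (A * A)%g = (F * H)%g :\: (c *: H)%g)
           /\ #|(A * A)%g| = ((#|F| - 1) * #|H|)%N))
  /\ (forall (F H : {group 'rV['F_2]_r}) (S A : {set 'rV['F_2]_r}),
        (F : {set 'rV['F_2]_r}) != [set 0] -> F :&: H = [set 0] ->
        antisymmetric_subset F S -> trimmed_shift S H A ->
        #|(A * A)%g| = ((#|F| - #|period S|) * #|H|)%N
        /\ ((#|F| - #|period S|) * #|H| < 2 * #|A|)%N).
Proof.
have comm (x y : 'rV['F_2]_r) : (x * y = y * x)%g by apply: addrC.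
have sq := @rVF2_sq r.
split=> [A lt | F H S A _ tiFH /existsP[h0 /and5P[Fh0 _ _ /eqP FE dS]] [g [sA few]]]; last first.
  split.
    exact: (trimmed_sumset_card comm sq Fh0 FE dS tiFH sA few).
  exact: (trimmed_small_doubling comm sq FE dS tiFH sA few).
split.
  have [[H [g HA]] | [F [H [S [h0 [g [F8 tiFH aS S1 tA]]]]]]] :=
    small_doubling_classification comm sq lt.
    by left; exists H, g.
  right; exists F, H, S; split=> //.
  - by apply/existsP; exists h0.
  - exact/eqP.
  - by exists g.
move=> F H S [_ tiFH /existsP[h0 /and5P[Fh0 _ _ /eqP FE dS]] /eqP S1 [g [sA few]]].
split.
  exists h0; first by rewrite -(mulg1 h0) mem_mulg.
  exact: (trimmed_aperiodic_sumset comm sq Fh0 FE dS tiFH sA few S1).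
rewrite (trimmed_sumset_card comm sq Fh0 FE dS tiFH sA few).
by rewrite -[stab S]/(period S) S1 cards1.
Qed.
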